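(* For every stream $s$: if the set $\mathcal{R}_s$ of red positions of $s$ is streamless, then $\neg\,\nu\mathcal{U}\,s$ (i.e. $s$ is not infinitely often red).
   Context: The statement is to be proved constructively (intuitionistic type theory with inductive and coinductive definitions; no excluded middle, no Markov's principle). A color is one of $R$ (red), $B$ (blue). A stream is an element of the coinductive type whose only constructor forms $c\,s$ from a color $c$ and a stream $s$; streams are considered up to bisimilarity (equivalently, functions $\mathbb{N}\to\{R,B\}$ up to pointwise equality). $s@n$ denotes the color of $s$ at position $n$ (positions start at $0$). $\mathcal{R}_s=\{n\in\mathbb{N}\mid s@n=R\}$. For a set $A$, the duplicate-free colists $\mathit{colist}\,A$ over $A$ are defined coinductively: $\langle\rangle:\mathit{colist}\,A$; and if $x\in A$ and $\ell:\mathit{colist}\,(A\setminus\{x\})$ then $x\,\ell:\mathit{colist}\,A$. Finiteness $\ell\downarrow$ of a colist is defined inductively: $\langle\rangle\downarrow$; and $\ell\downarrow$ implies $(x\,\ell)\downarrow$. $A$ is streamless if $\ell\downarrow$ for every $\ell:\mathit{colist}\,A$. For a stream predicate $X$, the strong until predicate $\mathcal{U}_X$ is defined inductively by the rules: $\mathcal{U}_X\,s$ implies $\mathcal{U}_X\,(B\,s)$; $X\,s$ implies $\mathcal{U}_X\,(R\,s)$. $\nu\mathcal{U}$ is the greatest fixed point of the monotone operator $X\mapsto\mathcal{U}_X$, i.e. the predicate defined coinductively by the rule: $\mathcal{U}_{\nu\mathcal{U}}\,s$ implies $\nu\mathcal{U}\,s$. *)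

(* Defs.v *)
From Stdlib Require Import Streams.

Inductive color : Set := R | B.

Definition red_positions (s : Stream color) : nat -> Prop :=
  fun n => Str_nth n s = R.

(* Subsets of [T] are predicates, so that [A \ {x}] excludes [x] by equality in
   [T] and the membership proofs carried by [cocons] are never compared. *)
CoInductive colist {T : Type} (A : T -> Prop) : Type :=
| conil : colist A
| cocons (x : T) : A x -> colist (fun y => A y /\ y <> x) -> colist A.

Arguments conil {T A}.
Arguments cocons {T A} x _ _.

Inductive finite {T : Type} : forall A : T -> Prop, colist A -> Prop :=
| finite_conil (A : T -> Prop) : finite A conil
| finite_cocons (A : T -> Prop) (x : T) (Ax : A x)
    (l : colist (fun y => A y /\ y <> x)) :
    finite _ l -> finite A (cocons x Ax l).

Definition streamless {T : Type} (A : T -> Prop) : Prop :=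
  forall l : colist A, finite A l.

Inductive until (X : Stream color -> Prop) : Stream color -> Prop :=
| until_B (s : Stream color) : until X s -> until X (Cons B s)
| until_R (s : Stream color) : X s -> until X (Cons R s).

CoInductive nuU (s : Stream color) : Prop :=
| nuU_intro : until nuU s -> nuU s.

(* Main.v *)
(** If [nuU s] holds, iterating the search for the next red position enumerates
    red positions of [s] in increasing order, hence without duplicates and
    forever; this is an infinite colist over [red_positions s]. *)
Require Import Defs.
From Stdlib Require Import Streams Lia.

(* Transparent, with an absurd elimination in the red case, so that the guard
   checker sees the result as a subterm of the given proof. *)
Lemma until_B_inv (X : Stream color -> Prop) (s t : Stream color) :
  until X s -> s = Cons B t -> until X t.
Proof.
  intros [s' u | s' _] e.
  - exact (match f_equal (@tl color) e in _ = t' return until X t' with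
           | eq_refl => u
           end).
  - discriminate e.
Defined.

Lemma until_R_inv (X : Stream color -> Prop) (s : Stream color) :
  until X (Cons R s) -> X s.
Proof. now inversion 1. Qed.

(* [until X s] is a proposition and cannot be analysed to produce the position;
   the recursion inspects [s] and uses [until X s] only for termination. *)
Fixpoint first_red (X : Stream color -> Prop) (s : Stream color)
    (u : until X s) {struct u} :
  {n : nat | Str_nth n s = R /\ X (Str_nth_tl (S n) s)}.
Proof.
  destruct s as [[|] s].
  - exists 0. split; [reflexivity | exact (until_R_inv X s u)].
  - destruct (first_red X s (until_B_inv X _ s u eq_refl)) as [n Hn].
    exists (S n). exact Hn.
Defined.

Lemma nuU_next_red (s : Stream color) (n : nat) :
  nuU (Str_nth_tl n s) ->
  {m : nat | n <= m /\ red_positions s m /\ nuU (Str_nth_tl (S m) s)}.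
Proof.
  intros H.
  assert (u : until nuU (Str_nth_tl n s)) by now destruct H.
  destruct (first_red nuU _ u) as [k [Hk Hnu]].
  (* [k] is counted from position [n], so the absolute position is [k + n]. *)
  exists (k + n). rewrite Str_nth_plus in Hk. rewrite Str_nth_tl_plus in Hnu.
  split; [lia | split; assumption].
Defined.

CoInductive infinite {T : Type} : forall A : T -> Prop, colist A -> Prop :=
| infinite_cocons (A : T -> Prop) (x : T) (Ax : A x)
    (l : colist (fun y => A y /\ y <> x)) :
    infinite _ l -> infinite A (cocons x Ax l).

(** With the match on [l] in the conclusion, a plain [destruct] does the inversion and no equality
    between dependent pairs arises. *)
Lemma infinite_tail {T : Type} (A : T -> Prop) (l : colist A) :
  infinite A l ->
  match l with
  | conil => False
  | cocons x _ l' => infinite (fun y => A y /\ y <> x) l'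
  end.
Proof. now destruct 1. Qed.

Lemma finite_not_infinite {T : Type} (A : T -> Prop) (l : colist A) :
  finite A l -> ~ infinite A l.
Proof.
  induction 1 as [A | A x Ax l _ IH]; intros Hinf.
  - exact (infinite_tail _ _ Hinf).
  - exact (IH (infinite_tail _ _ Hinf)).
Qed.

(** Invariant of the corecursion: the ambient set shrinks at each [cocons], but only by positions
    already passed. *)
Definition contains_reds_from (s : Stream color) (n : nat) (A : nat -> Prop) :
  Prop := forall m, n <= m -> red_positions s m -> A m.

Lemma contains_reds_from_remove (s : Stream color) (n m : nat)
    (A : nat -> Prop) :
  contains_reds_from s n A -> n <= m ->
  contains_reds_from s (S m) (fun y => A y /\ y <> m).
Proof.
  intros HA Hnm k Hk Hred. split; [apply HA; [lia | exact Hred] | lia].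
Qed.

CoFixpoint reds_from (s : Stream color) (n : nat) (A : nat -> Prop)
    (HA : contains_reds_from s n A) (H : nuU (Str_nth_tl n s)) : colist A :=
  match nuU_next_red s n H with
  | exist _ m (conj Hnm (conj Hred Hnu)) =>
      cocons m (HA m Hnm Hred)
        (reds_from s (S m) _ (contains_reds_from_remove s n m A HA Hnm) Hnu)
  end.

Definition colist_unfold {T : Type} {A : T -> Prop} (l : colist A) : colist A :=
  match l with
  | conil => conil
  | cocons x Ax l' => cocons x Ax l'
  end.

Lemma colist_unfold_eq {T : Type} {A : T -> Prop} (l : colist A) :
  l = colist_unfold l.
Proof. now destruct l. Qed.

Lemma infinite_reds_from (s : Stream color) :
  forall (n : nat) (A : nat -> Prop) (HA : contains_reds_from s n A)
    (H : nuU (Str_nth_tl n s)), infinite A (reds_from s n A HA H).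
Proof.
  cofix CIH. intros n A HA H.
  (* A cofixpoint reduces only under a match; [colist_unfold] supplies one and forces a single
     step. *)
  rewrite (colist_unfold_eq (reds_from s n A HA H)). simpl.
  destruct (nuU_next_red s n H) as [m [Hnm [Hred Hnu]]].
  constructor. apply CIH.
Qed.

Theorem lemma4p5 (s : Stream color) :
  streamless (red_positions s) -> ~ nuU s.
Proof.
  intros Hs H.
  assert (HA : contains_reds_from s 0 (red_positions s))
    by (intros m _ Hm; exact Hm).
  exact (finite_not_infinite _ _ (Hs _) (infinite_reds_from s 0 _ HA H)).
Qed.
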